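(* Let $\omega\in\mathbb{R}$ and $\theta=1/32$, and let $\boldsymbol{A}$ be the mask supported in $[-2,2]\cap\mathbb{Z}$ with $$\boldsymbol{A}_{-2}=\begin{bmatrix}\theta&-\frac{\theta}{2}\\-\frac{3\omega}{2}&\frac{\omega}{2}\end{bmatrix},\quad \boldsymbol{A}_{-1}=\begin{bmatrix}\frac12&-\frac18\\ \frac34&-\frac18\end{bmatrix},\quad \boldsymbol{A}_0=\begin{bmatrix}1-2\theta&0\\0&\frac{1+4\omega}{2}\end{bmatrix},\quad \boldsymbol{A}_1=\begin{bmatrix}\frac12&\frac18\\-\frac34&-\frac18\end{bmatrix},\quad \boldsymbol{A}_2=\begin{bmatrix}\theta&\frac{\theta}{2}\\ \frac{3\omega}{2}&\frac{\omega}{2}\end{bmatrix}.$$ Then the subdivision operator $S_{\boldsymbol{A}}$ satisfies the spectral condition of order $4$, with $4$-th spectral polynomial $\mathscr{P}_4(x)=\frac{1}{4!}x^4+\frac{1}{360}$, but the Hermite subdivision scheme associated with $S_{\boldsymbol{A}}$ does not reproduce polynomials of degree $4$ (i.e. not every real polynomial of degree $4$ is reproduced).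
   Context: The subdivision operator with a finitely supported mask $\boldsymbol{A}=(\boldsymbol{A}_j:j\in\mathbb{Z})$ of real $2\times2$ matrices acts on sequences $\mathbf{c}=(\mathbf{c}_j:j\in\mathbb{Z})$ in $\mathbb{R}^2$ by $(S_{\boldsymbol{A}}\mathbf{c})_j=\sum_{k\in\mathbb{Z}}\boldsymbol{A}_{j-2k}\mathbf{c}_k$. A function $f$ on $\mathbb{R}$ is identified with the sequence $(f(j):j\in\mathbb{Z})$ when $S_{\boldsymbol{A}}$ is applied to it. $D$ denotes differentiation, $Df=f'$. $\Pi_k$ is the set of real polynomials of degree $\le k$, and $\pi[j]$ denotes the coefficient of $x^j$ in $\pi$. Spectral condition of order $d$ ($d\ge1$): there exist polynomials $\mathscr{P}_k\in\Pi_k$ with $\mathscr{P}_k[k]=1/k!$ (called spectral polynomials) such that $S_{\boldsymbol{A}}\begin{bmatrix}\mathscr{P}_k\\ D\mathscr{P}_k\end{bmatrix}=2^{-k}\begin{bmatrix}\mathscr{P}_k\\ D\mathscr{P}_k\end{bmatrix}$ for $k=0,\ldots,d$. The Hermite subdivision scheme associated with $S_{\boldsymbol{A}}$ is the iteration $\boldsymbol{D}^{n+1}\mathbf{c}^{[n+1]}=S_{\boldsymbol{A}}\boldsymbol{D}^n\mathbf{c}^{[n]}$, $n=0,1,2,\dots$, with $\boldsymbol{D}=\mathrm{diag}(1,1/2)$. It reproduces a function $f\in C^1(\mathbb{R})$ if for initial data $\mathbf{c}^{[0]}_j=[f(j),f'(j)]^T$, $j\in\mathbb{Z}$, one has $\mathbf{c}^{[n]}_j=[f(2^{-n}j),f'(2^{-n}j)]^T$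 for all $j\in\mathbb{Z}$, $n\ge1$. *)

(* Defs.v *)
From HB Require Import structures.
From mathcomp Require Import all_boot all_order all_algebra.
From mathcomp Require Import all_classical all_reals all_analysis.
Set Implicit Arguments.
Unset Strict Implicit.
Unset Printing Implicit Defensive.
Import Order.TTheory GRing.Theory Num.Theory.
Import numFieldNormedType.Exports.
Local Open Scope classical_set_scope.
Local Open Scope ring_scope.

Definition mx2 (R : realType) (a b c d : R) : 'M[R]_2 :=
  \matrix_(i < 2, j < 2)
    (if i == 0 then if j == 0 then a else b else if j == 0 then c else d).

Definition cv2 (R : realType) (a b : R) : 'cV[R]_2 :=
  \col_(i < 2) (if i == 0 then a else b).

(* The sum over all of int is a sum over the finitely many k with a nonzero
   term; there are finitely many of them whenever A is finitely supported. *)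
Definition subdiv (R : realType) (A : int -> 'M[R]_2) (c : int -> 'cV[R]_2)
    (j : int) : 'cV[R]_2 :=
  \sum_(k \in [set: int]) (A (j - 2 * k) *m c k).

(* The sequence of samples [f(h j), f'(h j)]^T, j an integer. *)
Definition hermite_samples (R : realType) (f : R -> R) (h : R) (j : int)
    : 'cV[R]_2 :=
  cv2 (f (h * j%:~R)) (derive1 f (h * j%:~R)).

Definition spectral_polynomials (R : realType) (A : int -> 'M[R]_2) (d : nat)
    (P : nat -> {poly R}) : Prop :=
  forall k : nat, (k <= d)%N ->
    [/\ (size (P k) <= k.+1)%N,
        (P k)`_k = 1 / (k`!)%:R &
        forall j : int,
          subdiv A (hermite_samples (horner (P k)) 1) j =
          2 ^- k *: hermite_samples (horner (P k)) 1 j].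

Definition dilation (R : realType) : 'M[R]_2 := mx2 1 0 0 (1 / 2).

Definition hermite_scheme (R : realType) (A : int -> 'M[R]_2)
    (c : nat -> int -> 'cV[R]_2) : Prop :=
  forall (n : nat) (j : int),
    dilation R ^+ n.+1 *m c n.+1 j =
    subdiv A (fun i => dilation R ^+ n *m c n i) j.

(* Since diag(1, 1/2) is invertible, the initial data determine c; this is
   meant for f of class C^1. *)
Definition reproduces (R : realType) (A : int -> 'M[R]_2) (f : R -> R) : Prop :=
  forall c : nat -> int -> 'cV[R]_2,
    hermite_scheme A c ->
    (forall j : int, c 0%N j = hermite_samples f 1 j) ->
    forall (n : nat) (j : int), (1 <= n)%N ->
      c n j = hermite_samples f (2 ^- n) j.

Definition hermite_mask (R : realType) (theta omega : R) (j : int) : 'M[R]_2 :=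
  if j == -2 then
    mx2 theta              (- (theta / 2))
        (- (3 * omega / 2)) (omega / 2)
  else if j == -1 then
    mx2 (1 / 2) (- (1 / 8))
        (3 / 4) (- (1 / 8))
  else if j == 0 then
    mx2 (1 - 2 * theta) 0
        0               ((1 + 4 * omega) / 2)
  else if j == 1 then
    mx2 (1 / 2)     (1 / 8)
        (- (3 / 4)) (- (1 / 8))
  else if j == 2 then
    mx2 theta           (theta / 2)
        (3 * omega / 2) (omega / 2)
  else 0.

(* Main.v *)
Require Import Defs.
From HB Require Import structures.
From mathcomp Require Import all_boot all_order all_algebra.
From mathcomp Require Import all_classical all_reals all_analysis.
From mathcomp Require Import ring lra zify.
Import Order.TTheory GRing.Theory Num.Theory.
Import numFieldNormedType.Exports.
Local Open Scope classical_set_scope.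
Local Open Scope ring_scope.

(** A mask supported in [[-2, 2]] acts by [A_{-2} c_{m+1} + A_0 c_m + A_2 c_{m-1}]
    at [2m] and by [A_{-1} c_{m+1} + A_1 c_m] at [2m+1], so each spectral identity
    is a pair of polynomial identities in [m], here satisfied by [x^k / k!] for
    [k <= 3] and, for [theta = 1/32] only, by [x^4 / 4! + 1/360].  Reproduction
    fails for [x^4] already in the first step at the origin, where the scheme
    yields [-2 theta] instead of [0]. *)

Lemma mulmx_mx2_cv2 (R : realType) (a b c d x y : R) :
  mx2 a b c d *m cv2 x y = cv2 (a * x + b * y) (c * x + d * y).
Proof.
apply/matrixP => i j.
by rewrite !mxE !big_ord_recl big_ord0 !mxE /= addr0; case: ifP.
Qed.

Lemma add_cv2 (R : realType) (x y x' y' : R) :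
  cv2 x y + cv2 x' y' = cv2 (x + x') (y + y').
Proof. by apply/matrixP => i j; rewrite !mxE; case: ifP. Qed.

Lemma scale_cv2 (R : realType) (a x y : R) : a *: cv2 x y = cv2 (a * x) (a * y).
Proof. by apply/matrixP => i j; rewrite !mxE; case: ifP. Qed.

Lemma subdiv_even (R : realType) (A : int -> 'M[R]_2) (c : int -> 'cV[R]_2) :
  (forall i : int, (i < -2) || (2 < i) -> A i = 0) ->
  forall m : int,
  subdiv A c (2 * m) = A (-2) *m c (m + 1) + A 0 *m c m + A 2 *m c (m - 1).
Proof.
move=> A0 m; rewrite /subdiv (fsbigE [:: m + 1; m; m - 1]).
- rewrite !big_cons big_nil !in_setT /= addr0 addrA.
  by congr (A _ *m _ + A _ *m _ + A _ *m _); lia.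
- by rewrite /= !inE; lia.
- by [].
move=> k _; rewrite !inE => hk; rewrite A0 ?mul0mx//; lia.
Qed.

Lemma subdiv_odd (R : realType) (A : int -> 'M[R]_2) (c : int -> 'cV[R]_2) :
  (forall i : int, (i < -2) || (2 < i) -> A i = 0) ->
  forall m : int,
  subdiv A c (2 * m + 1) = A (-1) *m c (m + 1) + A 1 *m c m.
Proof.
move=> A0 m; rewrite /subdiv (fsbigE [:: m + 1; m]).
- rewrite !big_cons big_nil !in_setT /= addr0.
  by congr (A _ *m _ + A _ *m _); lia.
- by rewrite /= !inE; lia.
- by [].
move=> k _; rewrite !inE => hk; rewrite A0 ?mul0mx//; lia.
Qed.

Lemma hermite_mask_support (R : realType) (theta omega : R) (i : int) :
  (i < -2) || (2 < i) -> hermite_mask theta omega i = 0.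
Proof. by move=> hi; rewrite /hermite_mask !ifF//; lia. Qed.

(** Trading the analytic derivative for the formal one makes the spectral identities purely
    algebraic. *)
Lemma hermite_samples_poly (R : realType) (p : {poly R}) (h : R) (j : int) :
  hermite_samples (horner p) h j = cv2 p.[h * j%:~R] p^`().[h * j%:~R].
Proof. by rewrite /hermite_samples -derivE. Qed.

Lemma dilation_pow_right_inv (R : realType) (n : nat) :
  dilation R ^+ n *m mx2 1 0 0 2 ^+ n = 1%:M.
Proof.
set E := mx2 1 0 0 2.
have DE : dilation R *m E = 1%:M.
  apply/matrixP => -[[|[|//]] hi] -[[|[|//]] hj];
    by rewrite !mxE !big_ord_recl big_ord0 !mxE /=; field.
have ED : E *m dilation R = 1%:M := mulmx1C DE.
(* Commutation is what allows the product of the powers to be regrouped as a power of the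
   product. *)
have cDE : GRing.comm (dilation R) E by rewrite /GRing.comm -!mulmxE DE ED.
by rewrite mulmxE -exprMn_comm// -mulmxE DE expr1n.
Qed.

(** [reproduces] quantifies over all orbits of the scheme, so refuting it requires an actual orbit.
    The scheme says that [D^n c_n] is the [n]-th iterate of [subdiv A] on [c0]; multiplying by
    [diag(1, 2)^n] solves for [c_n]. *)
Lemma hermite_scheme_exists (R : realType) (A : int -> 'M[R]_2)
    (c0 : int -> 'cV[R]_2) :
  exists2 c, hermite_scheme A c & c 0%N = c0.
Proof.
exists (fun n j => mx2 1 0 0 2 ^+ n *m iter n (subdiv A) c0 j).
  move=> n j; rewrite mulmxA dilation_pow_right_inv mul1mx /=.
  congr subdiv; apply/funext => i.
  by rewrite mulmxA dilation_pow_right_inv mul1mx.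
by apply/funext => j /=; rewrite expr0 mul1mx.
Qed.

(** For [x^4/4! + c], the first row of the spectral identity at [j = 1] forces [c = 1/360], while at
    [j = 0] it forces [c = 4 theta / 45]; the two agree exactly when [theta = 1/32]. *)
Definition spectral_poly (R : realType) (k : nat) : {poly R} :=
  (1 / (k`!)%:R) *: 'X^k + (if k == 4%N then 1 / 360 else 0)%:P.

Lemma spectral_poly_mask (R : realType) (omega : R) :
  spectral_polynomials (hermite_mask (1 / 32) omega) 4 (@spectral_poly R).
Proof.
move=> k k4; split.
- rewrite (leq_trans (size_polyD _ _))// geq_max.
  rewrite (leq_trans (size_scale_leq _ _)) ?size_polyXn//.
  by rewrite (leq_trans (size_polyC_leq1 _)).
(* The constant could alter coefficient [k] only for [k = 0], where the correction is zero. *)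
- rewrite coefD coefZ coefXn eqxx coefC mulr1.
  by case: k k4 => [|k] _ /=; rewrite addr0.
move=> j.
have [m [->|->]] : exists m : int, j = 2 * m \/ j = 2 * m + 1.
  by exists (j %/ 2)%Z; lia.
- rewrite subdiv_even; last exact: hermite_mask_support.
  rewrite !hermite_samples_poly /hermite_mask /= !mulmx_mx2_cv2 !add_cv2.
  rewrite scale_cv2 !mul1r !rmorphD !rmorphM /=.
  rewrite /spectral_poly !derivD !derivZ !derivXn !derivC.
  rewrite !hornerE !hornerMn !hornerXn.
  (* For each of the five values of [k], both rows are polynomial identities in the indeterminate
     [m]. *)
  by move: k k4; do 5?[case] => //= _; congr cv2; rewrite ?factS ?fact0; field.
- rewrite subdiv_odd; last exact: hermite_mask_support.
  rewrite !hermite_samples_poly /hermite_mask /= !mulmx_mx2_cv2 !add_cv2.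
  rewrite scale_cv2 !mul1r !rmorphD !rmorphM /=.
  rewrite /spectral_poly !derivD !derivZ !derivXn !derivC.
  rewrite !hornerE !hornerMn !hornerXn.
  by move: k k4; do 5?[case] => //= _; congr cv2; rewrite ?factS ?fact0; field.
Qed.

Theorem mainTheorem3 (R : realType) (omega theta : R) (htheta : theta = 1 / 32) :
  (exists P : nat -> {poly R},
     spectral_polynomials (hermite_mask theta omega) 4 P /\
     P 4%N = (1 / (4`!)%:R) *: 'X^4 + (1 / 360)%:P) /\
  ~ (forall p : {poly R}, size p = 5%N ->
       reproduces (hermite_mask theta omega) (horner p)).
Proof.
rewrite htheta; split.
  by exists (@spectral_poly R); split; first exact: spectral_poly_mask.
move=> /(_ 'X^4 (size_polyXn _ _)) rep.
have [c cA c0] := hermite_scheme_exists R (hermite_mask (1 / 32) omega)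
  (hermite_samples (horner 'X^4) 1).
have c1 := rep c cA (fun j => congr1 (@^~ j) c0) 1%N 0 isT.
have := cA 0%N 0; rewrite c1 c0 expr1 expr0.
under [in RHS]eq_fun do rewrite mul1mx.
rewrite -[X in subdiv _ _ X](mulr0 2) subdiv_even;
  last exact: hermite_mask_support.
rewrite !hermite_samples_poly /hermite_mask /= /dilation !mulmx_mx2_cv2 !add_cv2.
(* The first entry is unaffected by the dilation: the left side is [0^4], the right side
   [2 theta - 4 theta = -1/16]. *)
move=> /(congr1 (fun v : 'cV[R]_2 => v 0 0)); rewrite !mxE /=.
rewrite derivXn !hornerE ?hornerMn ?hornerXn /=.
lra.
Qed.
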